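(* Let $G$ be a hyperbolic group, and let $H\subset G$ be a quasiconvex subgroup. If $[G:H]=\infty$, then there exists a (set-theoretic) section $s:G/H\to G$ of the quotient map $G\to G/H$, $g\mapsto gH$, such that $s(G/H)$ is a net in $G$; that is, $\sup_{g\in G} d(g,s(G/H))$ is finite.
   Context: All generating sets are finite and closed under inversion. For a group $G$ with generating set $\Sigma$, the Cayley graph $\Gamma=C(G,\Sigma)$ has vertex set $G$ and edges joining $g,g'$ with $g'=gc$ for some $c\in\Sigma$. Write $|g|_\Sigma$ for the word length of $g$ with respect to $\Sigma$ and $d(x,y)=|x^{-1}y|_\Sigma$; this metric is extended over the edges so that $\Gamma$ is a geodesic metric space. $G$ is hyperbolic if $\Gamma$ is a (Gromov-)hyperbolic geodesic space; this does not depend on $\Sigma$. A subgroup $H\subset G$ is $K$-quasiconvex ($K\ge 0$) if for all $p,q\in H$ every geodesic from $p$ to $q$ in $\Gamma$ lies in the closed $K$-neighborhood of $H$; it is quasiconvex if it is $K$-quasiconvex for some $K$. $G/H$ denotes the set of cosets $gH$ ($H$ need not be normal), and $s$ is only a map of sets. A subset $M'$ of a metric space $M$ is a net if there is a constant $C>0$ such that every point of $M$ is within distance $C$ of a point of $M'$; for subsets of a finitely generated group this is meant with respect to the word metric, and does not depend on the choice of finite generating set. *)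

(* Defs.v *)
From HB Require Import structures.
From mathcomp Require Import all_boot all_order all_algebra.
From mathcomp Require Import all_classical all_reals.

Set Implicit Arguments.
Unset Strict Implicit.
Unset Printing Implicit Defensive.

Import Order.TTheory GRing.Theory Num.Theory.

Local Open Scope classical_set_scope.
Local Open Scope ring_scope.

Section WordMetric.
Variables (G : groupType) (Sigma : set G).

Definition is_word_for (g : G) (w : seq G) : Prop :=
  (forall c, c \in w -> Sigma c) /\ (\prod_(c <- w) c)%g = g.

Definition generating_set : Prop :=
  [/\ finite_set Sigma,
      forall c, Sigma c -> Sigma (c^-1)%g
    & forall g, exists w, is_word_for g w].

(* The junk value 0 is only taken when no word over Sigma represents g. *)
Definition word_length (g : G) : nat :=
  let P n := `[< exists2 w, is_word_for g w & size w = n >] in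
  if pselect (exists n, P n) is left ex then ex_minn ex else 0%N.

Definition word_dist (R : realType) (x y : G) : R :=
  (word_length (x^-1 * y)%g)%:R.

End WordMetric.

(* Points of the geometric realization of the Cayley graph C(G, Sigma).
   [CayleyPoint g c t] with c in Sigma is the point at distance t from g on the
   edge of length 1 from g to g * c.  The vertex g itself is represented by
   [CayleyPoint g 1 0], also when 1 is not in Sigma.  A point of the realization
   has several representatives: the edge from g to g * c is also the edge from
   g * c to g, and a vertex is an end of each of its edges.  Representatives of
   the same point are at [cayley_dist] 0. *)
Record cayley_point (R : realType) (G : groupType) (Sigma : set G) :=
  CayleyPoint {
    cp_base : G;
    cp_dir : G;
    cp_pos : R;
    cp_pos_itv : 0 <= cp_pos <= 1;
    cp_on_edge : Sigma cp_dir \/ (cp_dir = 1%g /\ cp_pos = 0)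
  }.

Section CayleyGraph.
Variables (R : realType) (G : groupType) (Sigma : set G).

Let vertex_itv : 0 <= (0 : R) <= 1.
Proof. by rewrite lexx ler01. Qed.

Definition cayley_vertex (g : G) : cayley_point R Sigma :=
  CayleyPoint g vertex_itv (or_intror (conj erefl erefl)).

Local Notation d := (word_dist Sigma R).

(* Length of a shortest path from x to y that passes through an end of the edge
   carrying x and an end of the edge carrying y. *)
Definition dist_via_ends (x y : cayley_point R Sigma) : R :=
  let: CayleyPoint g c t _ _ := x in
  let: CayleyPoint g' c' t' _ _ := y in
  Num.min
    (Num.min (t + d g g' + t')
             (t + d g (g' * c')%g + (1 - t')))
    (Num.min ((1 - t) + d (g * c)%g g' + t')
             ((1 - t) + d (g * c)%g (g' * c')%g + (1 - t'))).

(* The path metric of the graph with edges of length 1.  Two points that lie on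
   the same edge, parametrized in the same or in the opposite direction, may
   also be joined inside that edge.  The order of the tests matters for a loop
   (c = 1), whose two directions must not be identified. *)
Definition cayley_dist (x y : cayley_point R Sigma) : R :=
  let: CayleyPoint g c t _ _ := x in
  let: CayleyPoint g' c' t' _ _ := y in
  if (g' == g) && (c' == c) then
    Num.min `|t - t'| (dist_via_ends x y)
  else if (g' == g * c)%g && (c' == c^-1)%g then
    Num.min `|t - (1 - t')| (dist_via_ends x y)
  else dist_via_ends x y.

End CayleyGraph.

Section GeodesicSpaces.
Variables (R : realType) (X : Type) (dist : X -> X -> R).

(* Only the values of gamma on [0, L] are relevant. *)
Definition is_geodesic (gamma : R -> X) (L : R) (x y : X) : Prop :=
  [/\ 0 <= L, gamma 0 = x, gamma L = y
    & forall s t, 0 <= s <= L -> 0 <= t <= L ->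
        dist (gamma s) (gamma t) = `|s - t| ].

Definition slim_triangles (delta : R) : Prop :=
  forall (x y z : X) (a b c : R -> X) (La Lb Lc : R),
    is_geodesic a La x y -> is_geodesic b Lb y z -> is_geodesic c Lc x z ->
    forall s, 0 <= s <= La ->
      (exists2 t, 0 <= t <= Lb & dist (a s) (b t) <= delta) \/
      (exists2 t, 0 <= t <= Lc & dist (a s) (c t) <= delta).

Definition gromov_hyperbolic : Prop :=
  exists2 delta : R, 0 <= delta & slim_triangles delta.

Definition is_net (N : set X) : Prop :=
  exists2 C : R, 0 < C & forall x, exists2 y, N y & dist x y <= C.

End GeodesicSpaces.

Section Subgroups.
Variables (G : groupType) (H : groupClosed G).

Definition left_coset (g : G) : set G := [set (g * h)%g | h in [set` H]].

Definition left_cosets : set (set G) := range left_coset.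

Definition coset_map (g : G) : left_cosets :=
  exist _ (left_coset g) (mem_set (imageT left_coset g)).

End Subgroups.

Definition hyperbolic (R : realType) (G : groupType) (Sigma : set G) : Prop :=
  gromov_hyperbolic (@cayley_dist R G Sigma).

(* A point at distance at most K from H is within K of some element of H,
   because its distances to the vertices form a discrete set. *)
Definition K_quasiconvex (R : realType) (G : groupType) (Sigma : set G)
    (H : groupClosed G) (K : R) : Prop :=
  forall p q : G, p \in H -> q \in H ->
  forall (gamma : R -> cayley_point R Sigma) (L : R),
    is_geodesic (@cayley_dist R G Sigma) gamma L
      (cayley_vertex R Sigma p) (cayley_vertex R Sigma q) ->
  forall s, 0 <= s <= L ->
    exists2 h, h \in H & cayley_dist (gamma s) (cayley_vertex R Sigma h) <= K.

Definition quasiconvex (R : realType) (G : groupType) (Sigma : set G)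
    (H : groupClosed G) : Prop :=
  exists2 K : R, 0 <= K & K_quasiconvex Sigma H K.

(* Main.v *)
(* The section s sends each coset to one of its shortest elements.  Given g far
   from 1, let q be a vertex on a geodesic [g, 1] at a suitable fixed distance
   from g.  Let b range over a large fixed ball, and suppose that s(gbH) is far
   from gb for every b.  Slimness of the triangles (g, 1, gb) and
   (1, gb, s(gbH)) puts q near the geodesic [gb, s(gbH)], hence, by
   quasiconvexity, near the coset gbH.  So all these cosets meet a ball around q
   whose radius depends only on the hyperbolicity and quasiconvexity constants.
   As [G : H] is infinite, the ball of the b's can be chosen so large that there
   are too many of them. *)

Require Import Defs.
From HB Require Import structures.
From mathcomp Require Import all_boot all_order all_algebra.
From mathcomp Require Import all_classical all_reals.
From mathcomp Require Import zify lra.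

Set Implicit Arguments.
Unset Strict Implicit.
Unset Printing Implicit Defensive.

Import Order.TTheory GRing.Theory Num.Theory.

Local Open Scope classical_set_scope.
Local Open Scope ring_scope.

(** * The word metric on vertices and its discrete geodesics *)

Section WordLength.
Variables (G : groupType) (Sigma : set G).
Hypothesis genSigma : generating_set Sigma.

Local Notation wl := (word_length Sigma).

Definition vdist (x y : G) : nat := wl (x^-1 * y)%g.

Definition vertex_geodesic (a : nat -> G) (n : nat) (x y : G) : Prop :=
  [/\ a 0%N = x, a n = y
    & forall i j : nat, (i <= j <= n)%N -> vdist (a i) (a j) = (j - i)%N].

Lemma word_lengthP (g : G) :
  (exists2 w, is_word_for Sigma g w & size w = wl g) /\
  (forall w, is_word_for Sigma g w -> (wl g <= size w)%N).
Proof.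
rewrite /word_length; case: pselect => [ex|nex]; last first.
  have [_ _ /(_ g) [w gw]] := genSigma.
  by case: nex; exists (size w); apply/asboolP; exists w.
case: ex_minnP => n /asboolP[w gw <-] min_w; split; first by exists w.
by move=> v gv; apply: min_w; apply/asboolP; exists v.
Qed.

Lemma word_length_le (w : seq G) :
  (forall c, c \in w -> Sigma c) -> (wl (\prod_(c <- w) c)%g <= size w)%N.
Proof. by move=> Sw; apply: (word_lengthP _).2. Qed.

Lemma word_length1 : wl 1%g = 0%N.
Proof.
by apply/eqP; rewrite -leqn0 -[1%g](big_nil 1%g *%g xpredT id) word_length_le.
Qed.

Lemma word_length_eq0 (g : G) : wl g = 0%N -> g = 1%g.
Proof.
have [[w [_ <-] <-] _] := word_lengthP g.
by move/size0nil ->; rewrite big_nil.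
Qed.

Lemma word_length_eq1 (g : G) : wl g = 1%N -> Sigma g.
Proof.
have [[w [Sw <-] <-] _] := word_lengthP g.
case: w Sw => [|c [|? ?]] // Sw _.
by rewrite big_cons big_nil mulg1; apply/Sw/mem_head.
Qed.

Lemma word_lengthM (g h : G) : (wl (g * h)%g <= wl g + wl h)%N.
Proof.
have [[v [Sv gE] <-] _] := word_lengthP g.
have [[w [Sw hE] <-] _] := word_lengthP h.
rewrite -size_cat -gE -hE -big_cat /=; apply: word_length_le => c.
by rewrite mem_cat => /orP[/Sv|/Sw].
Qed.

Lemma word_lengthV (g : G) : wl g^-1%g = wl g.
Proof.
have le_wlV h : (wl h^-1%g <= wl h)%N.
  have [[w [Sw <-] <-] _] := word_lengthP h.
  have [_ SV _] := genSigma.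
  rewrite -size_rev -(size_map (fun c => c^-1)%g) -[w in leqLHS]revK -prodgV.
  rewrite -(big_map (fun c => c^-1)%g xpredT id).
  by apply: word_length_le => c /mapP[b]; rewrite mem_rev => /Sw/SV ? ->.
by apply/eqP; rewrite eqn_leq le_wlV -{1}[g]invgK le_wlV.
Qed.

Lemma finite_ball (n : nat) : finite_set [set g : G | (wl g <= n)%N].
Proof.
elim: n => [|n IHn].
  apply: (@sub_finite_set _ _ [set 1%g]) => // g /=.
  by rewrite leqn0 => /eqP/word_length_eq0.
apply: sub_finite_set (_ : _ `<=` [set 1%g] `|`
  [set (c * h)%g | c in Sigma & h in [set h | (wl h <= n)%N]]) _.
  move=> g /=; have [[[|c w] [Sw <-] <-] _] := word_lengthP g.
    by left; rewrite /= big_nil.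
  move=> /= sz_w; right; rewrite big_cons; exists c; first exact/Sw/mem_head.
  exists (\prod_(b <- w) b)%g => //=; apply: leq_trans (word_length_le _) sz_w.
  by move=> b wb; apply: Sw; rewrite inE wb orbT.
rewrite finite_setU; split; first exact: finite_set1.
by apply: finite_image2 => //; have [] := genSigma.
Qed.

Lemma vdistxx x : vdist x x = 0%N.
Proof. by rewrite /vdist mulVg word_length1. Qed.

Lemma vdistC x y : vdist x y = vdist y x.
Proof. by rewrite /vdist -word_lengthV invgM invgK. Qed.

Lemma vdist_triangle y x z : (vdist x z <= vdist x y + vdist y z)%N.
Proof.
rewrite /vdist; have -> : (x^-1 * z = (x^-1 * y) * (y^-1 * z))%g.
  by rewrite !mulgA mulgK.
exact: word_lengthM.
Qed.

Lemma vdistM z x y : vdist (z * x)%g (z * y)%g = vdist x y.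
Proof. by rewrite /vdist invgM -mulgA mulKg. Qed.

Lemma vdist1 x : vdist x 1%g = wl x.
Proof. by rewrite vdistC /vdist invg1 mul1g. Qed.

(** The prefixes of a shortest word for [x^-1 * y] give points [a i] and [a j] at distance at most
    [j - i]. A strict inequality anywhere would make the route from [x] to [y] shorter than
    [vdist x y]. *)
Lemma vertex_geodesic_exists x y :
  exists a, vertex_geodesic a (vdist x y) x y.
Proof.
have [[w [Sw wE] sz_w] _] := word_lengthP (x^-1 * y)%g.
pose a i := (x * \prod_(c <- take i w) c)%g.
have a0 : a 0%N = x by rewrite /a take0 big_nil mulg1.
have an : a (vdist x y) = y by rewrite /a /vdist -sz_w take_size wE mulVKg.
have a_lip i j : (i <= j)%N -> (vdist (a i) (a j) <= j - i)%N.
  move=> leij; rewrite vdistM /vdist -(cat_take_drop i (take j w)).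
  rewrite take_takel // big_cat /= mulKg.
  apply: leq_trans (word_length_le _) _.
    by move=> c /mem_drop/mem_take/Sw.
  by rewrite size_drop size_take; case: ltnP; lia.
exists a; split=> // i j /andP[leij lejn].
have := a_lip i j leij; have := a_lip 0%N i isT; have := a_lip j _ lejn.
rewrite a0 an.
have := vdist_triangle (a i) x y; have := vdist_triangle (a j) (a i) y.
lia.
Qed.

Lemma vertex_geodesic_dist a n x y i j : vertex_geodesic a n x y ->
  (i <= n)%N -> (j <= n)%N -> vdist (a i) (a j) = ((j - i) + (i - j))%N.
Proof.
move=> [_ _ aE] lein lejn; case: (leqP i j) => ij.
  by rewrite aE ?ij //; lia.
by rewrite vdistC aE; lia.
Qed.

End WordLength.

(** * Distances between points of unit intervals on the real line *)

Section RealLine.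
Variable R : realType.
Implicit Types p q e f u v : R.

Lemma natr_itv (k n : nat) : (k <= n)%N -> 0 <= (k%:R : R) <= n%:R.
Proof. by move=> kn; rewrite ler0n ler_nat. Qed.

Lemma min4_eq (m p q r s : R) : m <= p -> m <= q -> m <= r -> m <= s ->
  [\/ p <= m, q <= m, r <= m | s <= m] ->
  Num.min (Num.min p q) (Num.min r s) = m.
Proof.
move=> mp mq mr ms le_m; apply/eqP; rewrite eq_le !ge_min !le_min.
rewrite mp mq mr ms andbT.
by case: le_m => ->; rewrite ?orbT.
Qed.

(* The points p + u and q + v of the real line, on the unit edges (or at the
   vertices, when e = 0 or f = 0) from p to p + e and from q to q + f. *)
Lemma dist_via_interval_ends p q e f u v :
  (e = 0 /\ u = 0) \/ (e = 1 /\ 0 < u < 1) ->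
  (f = 0 /\ v = 0) \/ (f = 1 /\ 0 < v < 1) ->
  [\/ p = q, p + 1 <= q | q + 1 <= p] ->
  let: D := `|p + u - (q + v)| in
  let: V := Num.min
    (Num.min (u + `|p - q| + v) (u + `|p - (q + f)| + (1 - v)))
    (Num.min ((1 - u) + `|p + e - q| + v)
             ((1 - u) + `|p + e - (q + f)| + (1 - v))) in
  V = D \/ [/\ p = q, e = 1, f = 1 & D <= V].
Proof.
move=> eu fv pq.
have [e01 f01] : 0 <= e <= 1 /\ 0 <= f <= 1.
  by case: eu => -[-> _]; case: fv => -[-> _]; rewrite ?lexx ?ler01.
have [u01 v01] : 0 <= u < 1 /\ 0 <= v < 1.
  by case: eu => -[_] => [->|/andP[/ltW -> ->]];
    case: fv => -[_] => [->|/andP[/ltW -> ->]]; rewrite ?lexx ?ltr01.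
move: e01 f01 u01 v01 => /andP[e0 e1] /andP[f0 f1] /andP[u0 u1] /andP[v0 v1].
case: pq => [<-|pq|qp].
- have -> : p + u - (p + v) = u - v by lra.
  rewrite subrr normr0.
  rewrite (_ : p - (p + f) = - f); last lra.
  rewrite (_ : p + e - p = e); last lra.
  rewrite (_ : p + e - (p + f) = e - f); last lra.
  rewrite normrN (ger0_norm e0) (ger0_norm f0).
  case: eu => -[-> u_]; case: fv => -[-> v_].
  + left; rewrite u_ v_ !subr0 normr0.
    by apply: min4_eq; try lra; apply: Or41; lra.
  + left; rewrite u_ !sub0r !normrN normr1 ger0_norm //.
    by apply: min4_eq; try lra; apply: Or41; lra.
  + left; rewrite v_ !subr0 normr1 ger0_norm //.
    by apply: min4_eq; try lra; apply: Or41; lra.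
  (* Two interior points of one edge: a route through the ends is at least as long as the direct
     segment, so only an inequality is available. *)
  + right; split => //; rewrite subrr normr0 !le_min !ler_norml.
    by do ?(apply/andP; split); lra.
(* The best route leaves through the right end [p + e]. For a vertex ([e = 0]) it is counted from
   [p] instead, because the other formulas charge an extra [1 - u = 1]. *)
- left; rewrite !ler0_norm; try lra.
  case: eu => -[eE u_]; apply: min4_eq; try lra.
    by apply: Or41; lra.
  by apply: Or43; lra.
- left; rewrite !ger0_norm; try lra.
  case: fv => -[fE v_]; apply: min4_eq; try lra.
    by apply: Or41; lra.
  by apply: Or42; lra.
Qed.

End RealLine.

(** * Realizing vertex geodesics in the Cayley graph *)

Section Realization.
Variables (R : realType) (G : groupType) (Sigma : set G).
Hypothesis genSigma : generating_set Sigma.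

Local Notation vertex := (cayley_vertex R Sigma).
Local Notation vd := (vdist Sigma).

Variant cayley_dist_spec (P Q : cayley_point R Sigma) : R -> Prop :=
| DistSameEdge of cp_base Q = cp_base P & cp_dir Q = cp_dir P :
    cayley_dist_spec P Q
      (Num.min `|cp_pos P - cp_pos Q| (dist_via_ends P Q))
| DistReversedEdge of cp_base Q = (cp_base P * cp_dir P)%g
    & cp_dir Q = (cp_dir P)^-1%g :
    cayley_dist_spec P Q
      (Num.min `|cp_pos P - (1 - cp_pos Q)| (dist_via_ends P Q))
| DistViaEnds of ~ (cp_base Q = cp_base P /\ cp_dir Q = cp_dir P) :
    cayley_dist_spec P Q (dist_via_ends P Q).

Lemma cayley_distP P Q : cayley_dist_spec P Q (cayley_dist P Q).
Proof.
case: P Q => [g c t t01 Pe] [g' c' t' t01' Qe]; rewrite /cayley_dist.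
case: ifP => [/andP[/eqP ? /eqP ?]|neq]; first exact: DistSameEdge.
case: ifP => [/andP[/eqP ? /eqP ?]|_]; first exact: DistReversedEdge.
by apply: DistViaEnds => /= -[gE cE]; rewrite gE cE !eqxx in neq.
Qed.

Lemma dist_via_endsE (P Q : cayley_point R Sigma) :
  dist_via_ends P Q = Num.min
    (Num.min (cp_pos P + (vd (cp_base P) (cp_base Q))%:R + cp_pos Q)
      (cp_pos P + (vd (cp_base P) (cp_base Q * cp_dir Q))%:R + (1 - cp_pos Q)))
    (Num.min
      ((1 - cp_pos P) + (vd (cp_base P * cp_dir P) (cp_base Q))%:R + cp_pos Q)
      ((1 - cp_pos P) + (vd (cp_base P * cp_dir P) (cp_base Q * cp_dir Q))%:R +
        (1 - cp_pos Q))).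
Proof. by case: P Q => [? ? ? ? ?] [? ? ? ? ?]. Qed.

(** A route through the ends of edges reaches an end of the edge of [P] before [P]. A shortcut
    inside an edge is considered only when [g] is the base of [P], and then the first distance is 0.
    This is what turns estimates at points of the graph into estimates at vertices. *)
Lemma cayley_dist_vertex_ge (g : G) (P : cayley_point R Sigma) :
  let: D := cayley_dist (vertex g) P in
  (vd g (cp_base P))%:R <= D \/ (vd g (cp_base P * cp_dir P)%g)%:R <= D.
Proof.
have via_ge : (vd g (cp_base P))%:R <= dist_via_ends (vertex g) P \/
    (vd g (cp_base P * cp_dir P)%g)%:R <= dist_via_ends (vertex g) P.
  rewrite dist_via_endsE /= !mulg1; have /andP[t0 t1] := cp_pos_itv P.
  have [d0 d0'] : 0 <= (vd g (cp_base P))%:R :> R /\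
    0 <= (vd g (cp_base P * cp_dir P)%g)%:R :> R by split; exact: ler0n.
  by rewrite /Num.min; do ?case: ifP => _; by [left; lra|right; lra].
have via_ge0 : 0 <= dist_via_ends (vertex g) P.
  by case: via_ge => via_ge; apply: le_trans via_ge; rewrite ler0n.
case: cayley_distP => [Pg _|Pg _|_]; last exact: via_ge.
all: have -> : cp_base P = g by rewrite Pg /= ?mulg1.
all: by left; rewrite (vdistxx genSigma) le_min normr_ge0.
Qed.

(* The point P, at parameter t, lies on the edge from a i to a j = a i.+1, or is
   the vertex a i = a j. *)
Definition on_vertex_path (a : nat -> G) (n : nat) (t : R)
    (P : cayley_point R Sigma) : Prop :=
  exists i j : nat, [/\ (i <= j <= n)%N,
    cp_base P = a i, (cp_base P * cp_dir P)%g = a j, t = i%:R + cp_pos P &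
    (j = i /\ P = vertex (a i)) \/ (j = i.+1 /\ 0 < cp_pos P < 1)].

(** Since [a] is isometric on [[0, n]], the four routes through ends have the lengths computed on
    the real line with [p = i], [q = i'], [e = j - i] and [f = j' - i']. Only interior points of a
    common edge need the direct segment. *)
Lemma on_vertex_path_dist a n x y s t P Q : vertex_geodesic Sigma a n x y ->
  on_vertex_path a n s P -> on_vertex_path a n t Q ->
  cayley_dist P Q = `|s - t|.
Proof.
move=> geo [i [j [ijn Pi Pj -> Pij]]] [i' [j' [ijn' Qi Qj -> Qij]]].
have a_inj k l : (k <= n)%N -> (l <= n)%N -> a k = a l -> k = l.
  move=> kn ln akl; have := vertex_geodesic_dist genSigma geo kn ln.
  rewrite akl vdistxx //; lia.
have distR k l : (k <= n)%N -> (l <= n)%N ->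
    (vd (a k) (a l))%:R = `|k%:R - l%:R| :> R.
  move=> kn ln; rewrite (vertex_geodesic_dist genSigma geo) //.
  case: (leqP k l) => [kl|/ltnW kl].
    by rewrite distrC -natrB // ger0_norm ?ler0n //; congr _%:R; lia.
  by rewrite -natrB // ger0_norm ?ler0n //; congr _%:R; lia.
have posE S k l :
    (l = k /\ S = vertex (a k)) \/ (l = k.+1 /\ 0 < cp_pos S < 1) ->
    l%:R = k%:R + (l - k)%N%:R :> R /\
    (((l - k)%N%:R = 0 :> R /\ cp_pos S = 0) \/
     ((l - k)%N%:R = 1 :> R /\ 0 < cp_pos S < 1)).
  case=> [[-> ->]|[-> S01]]; first by rewrite subnn addr0; split => //; left.
  by rewrite subSnn natr1; split => //; right.
have [jE posP] := posE _ _ _ Pij; have [jE' posQ] := posE _ _ _ Qij.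
have pq : [\/ i%:R = i'%:R :> R, i%:R + 1 <= i'%:R :> R
    | i'%:R + 1 <= i%:R :> R].
  rewrite !natr1 !ler_nat; case: (ltngtP i i') => [_|_|->].
  - exact: Or32.
  - exact: Or33.
  - exact: Or31.
have := dist_via_interval_ends posP posQ pq.
rewrite -jE -jE' -!distR; try lia.
rewrite -Pj -Qj -Pi -Qi -dist_via_endsE.
set D := `|_| => via.
case: cayley_distP.
- move=> QPb QPd; have ii' : i = i'.
    by apply: a_inj; [lia|lia|rewrite -Pi -Qi].
  have jj' : j = j'.
    by apply: a_inj; [lia|lia|rewrite -Pj -Qj QPb QPd].
  have -> : `|cp_pos P - cp_pos Q| = D.
    by rewrite /D ii' opprD addrACA subrr add0r.
  by case: via => [->|[_ _ _ leD]]; [rewrite minxx|rewrite min_l].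
(* Both edges point forward along the geodesic, so a reversal gives [i <= j = i' <= j' = i]: the two
   points are the same vertex. *)
- move=> QPb QPd; have ji' : j = i'.
    by apply: a_inj; [lia|lia|rewrite -Pj -Qi].
  have ij' : i = j'.
    by apply: a_inj; [lia|lia|rewrite -Pi -Qj QPb QPd mulgK].
  have [ji i'i] : j = i /\ i' = i by lia.
  have eN1 : (j - i)%N%:R <> 1 :> R.
    by move/eqP; rewrite ji subnn eq_sym oner_eq0.
  have P0 : cp_pos P = 0 by case: posP => -[].
  have Q0 : cp_pos Q = 0.
    by case: posQ => -[] //; rewrite -ij' i'i -{1}ji => /eN1.
  case: via => [->|[]//].
  by rewrite min_r // /D i'i P0 Q0 subrr normr0.
(* The exceptional case would give both points the same base and direction, which [edgeN]
   excludes. *)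
- move=> edgeN; case: via => // -[/eqP ii' /eqP jE1 /eqP jE1' _].
  case: edgeN; move: Qj Qi Pi Pj; rewrite eqr_nat in ii'.
  move: jE1 jE1'; rewrite !pnatr_eq1 => /eqP jE1 /eqP jE1'.
  have -> : j' = j by rewrite (eqP ii') in jE1; lia.
  rewrite -(eqP ii') => Qj Qi Pi Pj; rewrite Pi Qi; split => //.
  by apply: (@mulgI _ (a i)); rewrite -{1}Qi Qj -Pj Pi.
Qed.

Lemma on_vertex_path_exists a n x y t : vertex_geodesic Sigma a n x y ->
  0 <= t <= n%:R -> exists P, on_vertex_path a n t P.
Proof.
move=> geo /andP[t0 tn].
have /andP[] := truncn_itv t0; set i := Num.truncn t => it ti.
have lein : (i <= n)%N by rewrite -(ler_nat R) (le_trans it).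
have [tE|tNi] := eqVneq t i%:R.
  exists (vertex (a i)); exists i, i; rewrite /= mulg1 addr0 leqnn lein.
  by split => //; left.
have lt_in : (i < n)%N.
  by rewrite -(ltr_nat R) (lt_le_trans _ tn) // lt_neqAle eq_sym tNi.
have u01 : 0 < t - i%:R < 1.
  rewrite subr_gt0 lt_neqAle eq_sym tNi it /=.
  by rewrite ltrBlDl natr1.
(* Consecutive vertices are at distance 1, so they differ by a single letter, which supplies the
   edge carrying the point. *)
have Sc : Sigma ((a i)^-1 * a i.+1)%g.
  apply: (word_length_eq1 genSigma); rewrite -[LHS]/(vd (a i) (a i.+1)).
  by case: geo => _ _ ->; lia.
have u01' : 0 <= t - i%:R <= 1 by case/andP: u01 => /ltW-> /ltW->.
exists (CayleyPoint (a i) u01' (or_introl Sc)); exists i, i.+1.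
rewrite /= mulVKg leqnSn lt_in; split => //; last by right.
by rewrite addrC subrK.
Qed.

Lemma on_vertex_path_nat a n x y (k : nat) P : vertex_geodesic Sigma a n x y ->
  on_vertex_path a n k%:R P -> P = vertex (a k).
Proof.
move=> geo [i [j [ijn Pi Pj kE [[_ PE]|[_ /andP[P0 P1]]]]]].
  rewrite PE; congr (vertex (a _)).
  by apply/eqP; rewrite -(eqr_nat R) kE PE /= addr0.
have ik : (i < k)%N by rewrite -(ltr_nat R) kE ltrDl.
have : (k < i.+1)%N by rewrite -(ltr_nat R) kE -natr1 ltrD2l.
lia.
Qed.

(** This lets hypotheses on geodesics of the Cayley graph be applied to vertex geodesics. *)
Lemma cayley_geodesic_exists a n x y : vertex_geodesic Sigma a n x y ->
  exists gamma : R -> cayley_point R Sigma,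
    [/\ is_geodesic (@cayley_dist R G Sigma) gamma n%:R (vertex x) (vertex y),
        forall k, (k <= n)%N -> gamma k%:R = vertex (a k) &
        forall t : R, 0 <= t <= n%:R -> on_vertex_path a n t (gamma t)].
Proof.
(* The range condition is part of the relation, so that choice applies to every real; outside
   [[0, n]] the point [vertex x] serves as a default. *)
move=> geo; pose Q t P := 0 <= t <= n%:R -> on_vertex_path a n t P.
have [gamma gammaP] : {f : R -> cayley_point R Sigma & forall t, Q t (f t)}.
  apply: choice => t; rewrite /Q.
  have [/(on_vertex_path_exists geo)[P aP]|_] := boolP (0 <= t <= n%:R).
    by exists P.
  by exists (vertex x).
have gamma_nat k : (k <= n)%N -> gamma k%:R = vertex (a k).
  by move=> kn; apply: (on_vertex_path_nat geo); apply/gammaP/natr_itv.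
exists gamma; split => //; have [a0 an _] := geo; split; first exact: ler0n.
- by rewrite (gamma_nat 0%N) ?a0.
- by rewrite gamma_nat ?an.
- by move=> s t sn tn; apply: (on_vertex_path_dist geo); apply: gammaP.
Qed.

End Realization.

(** * Slim triangles and quasiconvexity for vertices *)

Section VertexHyperbolicity.
Variables (R : realType) (G : groupType) (Sigma : set G).
Hypothesis genSigma : generating_set Sigma.

Local Notation vd := (vdist Sigma).
Local Notation wl := (word_length Sigma).
Local Notation vgeodesic := (vertex_geodesic Sigma).

Definition slim_vertex_triangles (delta : nat) : Prop :=
  forall x y z a b c na nb nc, vgeodesic a na x y -> vgeodesic b nb y z ->
  vgeodesic c nc x z -> forall i, (i <= na)%N ->
    (exists2 j, (j <= nb)%N & (vd (a i) (b j) <= delta)%N) \/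
    (exists2 j, (j <= nc)%N & (vd (a i) (c j) <= delta)%N).

(** Formulated for sets rather than subgroups because it is applied to left cosets. *)
Definition vertex_quasiconvex (A : set G) (k : nat) : Prop :=
  forall p q a n, A p -> A q -> vgeodesic a n p q ->
  forall i, (i <= n)%N -> exists2 h, A h & (vd (a i) h <= k)%N.

(** Some end of the edge of [P] is no farther from [g] than [P] is, and an integer bounded by [D] is
    bounded by its integer part. *)
Lemma on_vertex_path_near a n t (P : cayley_point R Sigma) (g : G) (D : R) :
  on_vertex_path a n t P -> cayley_dist (cayley_vertex R Sigma g) P <= D ->
  exists2 j, (j <= n)%N & (vd g (a j) <= Num.truncn D)%N.
Proof.
move=> [i [j [/andP[ij jn] Pi Pj _ _]]] PD.
have [] := cayley_dist_vertex_ge genSigma g P => /le_trans/(_ PD) gD.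
  exists i; first exact: leq_trans jn.
  by rewrite truncn_ge_nat ?(le_trans _ gD) // -Pi.
by exists j => //; rewrite truncn_ge_nat ?(le_trans _ gD) // -Pj.
Qed.

Lemma hyperbolic_slim_vertex_triangles :
  hyperbolic R Sigma -> exists delta, slim_vertex_triangles delta.
Proof.
move=> [D D0 slim]; exists (Num.truncn D) => x y z a b c na nb nc.
move=> ga gb gc i ilen.
have [a' [a'P a'V aP]] := cayley_geodesic_exists R genSigma ga.
have [b' [b'P b'V bP]] := cayley_geodesic_exists R genSigma gb.
have [c' [c'P c'V cP]] := cayley_geodesic_exists R genSigma gc.
have iR := natr_itv R ilen.
have [[t tn]|[t tn]] := slim _ _ _ _ _ _ _ _ _ a'P b'P c'P _ iR;
  rewrite (a'V _ ilen).
  by move/(on_vertex_path_near (bP _ tn)); left.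
by move/(on_vertex_path_near (cP _ tn)); right.
Qed.

Lemma quasiconvex_vertices (H : groupClosed G) :
  quasiconvex R Sigma H -> exists k, vertex_quasiconvex [set` H] k.
Proof.
move=> [K K0 qc]; exists (Num.truncn K) => p q a n Hp Hq ga i ilen.
have [a' [a'P a'V aP]] := cayley_geodesic_exists R genSigma ga.
have iR := natr_itv R ilen.
have [h Hh] := qc p q Hp Hq _ _ a'P _ iR.
rewrite (a'V _ ilen) => hK; exists h => //.
have vdK : (vd (a i) h)%:R <= K.
  apply: le_trans hK.
  have := cayley_dist_vertex_ge genSigma (a i) (cayley_vertex R Sigma h).
  by rewrite -[cp_base _]/h -[cp_dir _]/1%g mulg1 => -[].
by rewrite truncn_ge_nat.
Qed.

Lemma vertex_geodesicM z a n x y : vgeodesic a n x y ->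
  vgeodesic (fun i => z * a i)%g n (z * x)%g (z * y)%g.
Proof. by case=> <- <- aE; split => // i j ij; rewrite vdistM aE. Qed.

(** Left translation is an isometry, so a geodesic can be pulled back by [z^-1]; the constant does
    not change. *)
Lemma vertex_quasiconvexM (A : set G) k z : vertex_quasiconvex A k ->
  vertex_quasiconvex [set z * h | h in A]%g k.
Proof.
move=> qc _ _ a n [p Ap <-] [q Aq <-] /(vertex_geodesicM z^-1%g).
rewrite !mulKg.
move=> /(qc _ _ _ _ Ap Aq) geo i /geo[h Ah]; rewrite -(vdistM _ z) mulVKg => hk.
by exists (z * h)%g => //; exists h.
Qed.

Lemma vertex_geodesic_dist_ends a n x y i : vgeodesic a n x y -> (i <= n)%N ->
  vd x (a i) = i /\ vd (a i) y = (n - i)%N.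
Proof.
move=> [<- <- aE] ilen; split; first by rewrite aE ?subn0.
by rewrite aE ?ilen /=.
Qed.

(* If the far point q of [g, 1] were not near [x, y], it would be near [y, 1],
   and y, being the point of A closest to 1, would then be near x. *)
Lemma quasiconvex_near_ray (A : set G) (delta k C T : nat) g x y a :
  slim_vertex_triangles delta -> vertex_quasiconvex A k ->
  A x -> A y -> (forall z, A z -> (wl y <= wl z)%N) ->
  vgeodesic a (wl g) g 1%g -> (T <= wl g)%N -> (C + delta < T)%N ->
  (vd g x <= C)%N -> (2 * (C + T + 2 * delta) < vd x y)%N ->
  exists2 z, A z & (vd (a T) z <= 2 * delta + k)%N.
Proof.
move=> slim qc Ax Ay y_min ga Tg CT gx xy.
have [gq _] := vertex_geodesic_dist_ends ga Tg.
have [b gb] := vertex_geodesic_exists genSigma 1%g x.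
have [c gc] := vertex_geodesic_exists genSigma g x.
have [e ge] := vertex_geodesic_exists genSigma x y.
have [f gf] := vertex_geodesic_exists genSigma 1%g y.
have tri := vdist_triangle genSigma.
have [[j jb qj]|[j jc qj]] := slim _ _ _ _ _ _ _ _ _ ga gb gc T Tg; last first.
  (* The side from [g] to [x] has length at most [C], whereas [a T] is at distance [T > C + delta]
     from [g]. *)
  have [cj _] := vertex_geodesic_dist_ends gc jc.
  have := tri (c j) g (a T); have := vdistC genSigma (c j) (a T); lia.
have [[i ie ji]|[i jf ji]] := slim _ _ _ _ _ _ _ _ _ gb ge gf j jb.
  have [z Az iz] := qc _ _ _ _ Ax Ay ge i ie; exists z => //.
  have := tri (b j) (a T) z; have := tri (e i) (b j) z; lia.
have wlE z : vd 1%g z = wl z by rewrite (vdistC genSigma) (vdist1 genSigma).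
have [f1i fiy] := vertex_geodesic_dist_ends gf jf.
(* Here [f i] is within [2 * delta] of [a T], hence within [C + T + 2 * delta] of [x]. As [f i] lies
   on the geodesic from 1 to [y] and [y] is no longer than [x], the same bound holds from [f i] to
   [y], against the lower bound on [vd x y]. *)
have := y_min _ Ax; rewrite -!wlE.
have := tri (f i) 1%g x; have := tri (f i) x y.
have := tri (a T) x (f i); have := tri (b j) (a T) (f i); have := tri g x (a T).
have := vdistC genSigma g x; have := vdistC genSigma x (f i).
lia.
Qed.

(** Pigeonhole: fix more cosets than the ball of radius [r] has elements, and let [C] bound the
    lengths of their representatives. For each [u] the cosets of the [u * e] are too few to cover
    them all, and [C] does not depend on [u]. *)
Lemma infinite_cosets_escape (H : groupClosed G) (r : nat) :
  infinite_set (left_cosets H) ->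
  exists C, forall u, exists2 b, (wl b <= C)%N &
    forall e, (wl e <= r)%N -> left_coset H b <> left_coset H (u * e)%g.
Proof.
have [E EE] := (finite_seqP _).1 (finite_ball genSigma r).
move=> /(infinite_set_fset (size E).+1)[B BH sizeB].
have [rep repP] : {rep : set G -> G & forall A, left_cosets H A ->
    left_coset H (rep A) = A}.
  apply: (@choice _ _ (fun A b => left_cosets H A -> left_coset H b = A)) => A.
  have [[b _ <-]|nA] := pselect (left_cosets H A); first by exists b.
  by exists 1%g.
exists (\max_(A <- finmap.enum_fset B) wl (rep A)) => u; apply: contrapT => noC.
suff: (size (finmap.enum_fset B) <=
       size [seq left_coset H (u * e)%g | e <- E])%N.
  by rewrite size_map leqNgt sizeB.
apply: uniq_leq_size; first exact: finmap.fset_uniq.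
move=> A AB; apply/mapP; apply: contrapT => noE; apply: noC.
exists (rep A).
  exact: (@leq_bigmax_seq _ _ xpredT (fun A => wl (rep A)) A AB isT).
move=> e er; rewrite repP; last exact: BH.
move=> AE; apply: noE; exists e => //.
by have : [set` E] e by rewrite -EE.
Qed.

End VertexHyperbolicity.

(** * Left cosets and their shortest elements *)

Section Cosets.
Variables (G : groupType) (H : groupClosed G).

Lemma left_coset_refl x : left_coset H x x.
Proof. by exists 1%g; rewrite ?mulg1 //=; exact: gpred1. Qed.

Lemma left_coset_eq x y : left_coset H x y -> left_coset H y = left_coset H x.
Proof.
move=> [h /= Hh <-]; apply/seteqP; split=> _ [k /= Hk <-].
  by exists (h * k)%g; rewrite ?mulgA //=; exact: gpredM.
exists (h^-1 * k)%g; first by rewrite /= gpredM ?gpredV.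
by rewrite -mulgA mulVKg.
Qed.

Lemma left_coset_mull z x y :
  left_coset H x y -> left_coset H (z * x)%g (z * y)%g.
Proof. by move=> [h Hh <-]; exists h; rewrite ?mulgA. Qed.

End Cosets.

Lemma shortest_exists (G : groupType) (Sigma A : set G) x : A x ->
  exists2 y, A y &
    forall z, A z -> (word_length Sigma y <= word_length Sigma z)%N.
Proof.
move=> Ax; pose P n := `[< exists2 z, A z & word_length Sigma z = n >].
have exP : exists n, P n.
  by exists (word_length Sigma x); apply/asboolP; exists x.
have [_ /asboolP[y Ay <-] y_min] := ex_minnP exP.
by exists y => // z Az; apply: y_min; apply/asboolP; exists z.
Qed.

Theorem theorem5p4 (R : realType) (G : groupType) (Sigma : set G)
    (genSigma : generating_set Sigma) (hypG : hyperbolic R Sigma)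
    (H : groupClosed G) (qcH : quasiconvex R Sigma H)
    (infH : infinite_set (left_cosets H)) :
  exists2 s : left_cosets H -> G,
    cancel s (coset_map H) & is_net (word_dist Sigma R) (range s).
Proof.
have [delta slim] := hyperbolic_slim_vertex_triangles genSigma hypG.
have [k qc] := quasiconvex_vertices genSigma qcH.
have [C escape] := infinite_cosets_escape genSigma (2 * delta + k) infH.
have [s sP] : {s : left_cosets H -> G & forall A : left_cosets H,
    sval A (s A) /\
    forall z, sval A z -> (word_length Sigma (s A) <= word_length Sigma z)%N}.
  apply: (@choice _ _ (fun A y => sval A y /\
    forall z, sval A z -> (word_length Sigma y <= word_length Sigma z)%N)).
  case=> A /= /set_mem[x _ <-].
  by have [y] := shortest_exists Sigma (left_coset_refl H x); exists y.
exists s.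
  move=> A; apply: val_inj => /=; have [+ _] := sP A.
  by have [x _ <-] := set_mem (valP A); exact: left_coset_eq.
(* [T] and [M] are the thresholds of [quasiconvex_near_ray]. [N] covers both direct cases: [2 * T]
   when [g] is shorter than [T], and [M + C] when the section passes near [g * b]. The successor
   makes it positive. *)
pose T := (C + delta).+1; pose M := (2 * (C + T + 2 * delta))%N.
pose N := (M + C + 2 * T).+1.
suff netN g : exists x, (vdist Sigma g (s (coset_map H x)) <= N)%N.
  exists N%:R; first by rewrite ltr0n.
  move=> g; have [x xN] := netN g; exists (s (coset_map H x)).
    by exists (coset_map H x).
  by rewrite ler_nat.
have tri := vdist_triangle genSigma.
have [gT|Tg] := ltnP (word_length Sigma g) T.
  exists g; have [_ /(_ g (left_coset_refl H g))] := sP (coset_map H g).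
  have := tri 1%g g (s (coset_map H g)).
  rewrite (vdistC genSigma 1%g) !(vdist1 genSigma) /N; lia.
have [a ga] := vertex_geodesic_exists genSigma g 1%g.
rewrite (vdist1 genSigma) in ga.
(* With this [u], translating by [g] shows that the coset of [g * b] contains no point within
   [2 * delta + k] of [a T]. *)
have [b bC bq] := escape (g^-1 * a T)%g.
have [sx sx_min] := sP (coset_map H (g * b)%g); exists (g * b)%g.
have gx : (vdist Sigma g (g * b)%g <= C)%N by rewrite /vdist mulKg.
have [near|far] := leqP (vdist Sigma (g * b)%g (s (coset_map H (g * b)%g))) M.
  have := tri (g * b)%g g (s (coset_map H (g * b)%g)); rewrite /N; lia.
have [z xz qz] := quasiconvex_near_ray genSigma slim
  (vertex_quasiconvexM (z := (g * b)%g) qc) (left_coset_refl H _) sx sx_min ga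
  Tg (leqnn _) gx far.
case: (bq ((a T)^-1 * z)%g qz); rewrite -mulgA mulVKg.
by apply/esym/left_coset_eq; rewrite -[b](mulKg g); exact: left_coset_mull.
Qed.
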